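(* Let $H$ be a real inner product space with inner product $\langle\cdot,\cdot\rangle$ and associated norm $\|\cdot\|=\sqrt{\langle\cdot,\cdot\rangle}$, and let $x,y,z\in H$. (1) If $\langle x,y\rangle\langle x,z\rangle\langle y,z\rangle>0$, then \[ \|x\|^2\langle y,z\rangle^2+\|y\|^2\langle x,z\rangle^2+\|z\|^2\langle x,y\rangle^2\;\geq\;3\,\langle x,y\rangle\langle x,z\rangle\langle y,z\rangle. \] (2) If $\langle x,y\rangle\langle x,z\rangle\langle y,z\rangle<0$, then \[ \|x\|^2\langle y,z\rangle^2+\|y\|^2\langle x,z\rangle^2+\|z\|^2\langle x,y\rangle^2\;\geq\;-6\,\langle x,y\rangle\langle x,z\rangle\langle y,z\rangle. \] Both inequalities are sharp: for each of (1) and (2) there exist a real inner product space and vectors $x,y,z$ in it satisfying the corresponding strict sign hypothesis for which equality holds. *)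

(* Defs.v *)
From HB Require Import structures.
From mathcomp Require Import all_boot all_order all_algebra.
From mathcomp Require Import reals.

Set Implicit Arguments.
Unset Strict Implicit.
Unset Printing Implicit Defensive.

Import Order.TTheory GRing.Theory Num.Theory.
Local Open Scope ring_scope.

(* A real inner product space is a module over R with a form of type
   {dot H for idfun}: "hermitian" for the identity involution means symmetric
   bilinear, and Dot adds positive definiteness. *)
Definition ipnorm (R : realType) (H : lmodType R)
    (ip : {dot H for @idfun R}) (u : H) : R :=
  Num.sqrt (ip u u).

(* Main.v *)
Require Import Defs.
From HB Require Import structures.
From mathcomp Require Import all_boot all_order all_algebra.
From mathcomp Require Import reals.
From mathcomp Require Import ring lra.

Set Implicit Arguments.
Unset Strict Implicit.
Unset Printing Implicit Defensive.

Import Order.TTheory GRing.Theory Num.Theory.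
Local Open Scope ring_scope.

(** Write [a = <y,z>], [b = <x,z>], [c = <x,y>], [p = a b c], and let
    [S = |x|^2 a^2 + |y|^2 b^2 + |z|^2 c^2] be the left-hand side, which is the
    sum of the squared norms of the vectors [a x], [b y] and [c z].  These
    three vectors have the remarkable property that any two of them have inner
    product [p].

    Hence [|a x + b y + c z|^2 = S + 6 p], and its nonnegativity is the
    inequality [S >= - 6 p] ([weighted_norms_ge_opp6]).  For [S >= 3 p], the
    Cauchy-Schwarz inequality bounds each pairwise product of the three terms
    of [S] below by [p^2]; by [(u + v + w)^2 >= 3 (u v + v w + w u)] this gives
    [S^2 >= 9 p^2] ([weighted_norms_ge3]).

    Equality [S = 3 p] holds when [x = y = z], and [S = - 6 p] when
    [a x + b y + c z = 0].  For [p < 0] the latter forces [a x], [b y] and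
    [c z] to be the edge vectors of an equilateral triangle; the triangle of
    the standard basis vectors of [R^3] realises it with integer coordinates. *)

(** * Inner product inequalities *)

Section InnerProduct.
Variables (R : realType) (H : lmodType R) (ip : {dot H for @idfun R}).
Implicit Types u v x y z : H.

Lemma ip_sym u v : ip u v = ip v u.
Proof. by rewrite (hermitian_subproof u v) expr0 mul1r. Qed.

Lemma ip_ge0 u : 0 <= ip u u.
Proof.
have [->|u0] := eqVneq u 0; first by rewrite linear0l.
exact/ltW/neq0_dnorm_gt0.
Qed.

Lemma ipnorm_sqr u : ipnorm ip u ^+ 2 = ip u u.
Proof. by rewrite sqr_sqrtr // ip_ge0. Qed.

Lemma ip_cauchy_schwarz u v : ip u v ^+ 2 <= ip u u * ip v v.
Proof.
have [->|v0] := eqVneq v 0; first by rewrite !linear0r expr0n mulr0.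
have vv_gt0 : 0 < ip v v by exact: neq0_dnorm_gt0.
(* the component of u orthogonal to v, with the denominator <v,v> cleared *)
have := ip_ge0 (ip v v *: u - ip u v *: v).
rewrite linearBl /= !linearBr /= !linearZl_LR /= !linearZr_LR /= (ip_sym v u).
rewrite (_ : _ - _ = ip v v * (ip u u * ip v v - ip u v ^+ 2)); last by ring.
by rewrite pmulr_rge0 // subr_ge0.
Qed.

Lemma weighted_norms_ge_opp6 x y z :
  - 6 * (ip x y * ip x z * ip y z)
  <= ip x x * ip y z ^+ 2 + ip y y * ip x z ^+ 2 + ip z z * ip x y ^+ 2.
Proof.
have := ip_ge0 (ip y z *: x + ip x z *: y + ip x y *: z).
rewrite !linearDl /= !linearDr /= !linearZl_LR /= !linearZr_LR /=.
rewrite (ip_sym y x) (ip_sym z x) (ip_sym z y) => sq_ge0.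
rewrite -subr_ge0; apply: (le_trans sq_ge0).
by rewrite le_eqVlt; apply/orP; left; apply/eqP; ring.
Qed.

End InnerProduct.

(** Pairwise lower bounds stand in for a lower bound on [u v w]: they give the
    conclusion of the arithmetic-geometric mean inequality for three terms
    without cube roots. *)
Lemma ge3_of_pairwise_mul_ge_sqr (R : realDomainType) (u v w p : R) :
    0 <= u + v + w ->
    p ^+ 2 <= u * v -> p ^+ 2 <= u * w -> p ^+ 2 <= v * w ->
  3 * p <= u + v + w.
Proof.
move=> s_ge0 uv uw vw.
have [p_lt0|p_ge0] := ltP p 0; first by apply: le_trans s_ge0; lra.
rewrite -ler_sqr ?nnegrE //; last by rewrite mulr_ge0 ?ler0n.
have := sqr_ge0 (u - v); have := sqr_ge0 (u - w); have := sqr_ge0 (v - w).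
nra.
Qed.

Lemma weighted_norms_ge3 (R : realType) (H : lmodType R)
    (ip : {dot H for @idfun R}) (x y z : H) :
  3 * (ip x y * ip x z * ip y z)
  <= ip x x * ip y z ^+ 2 + ip y y * ip x z ^+ 2 + ip z z * ip x y ^+ 2.
Proof.
(* multiplying <u,v>^2 <= |u|^2 |v|^2 by the square of the weights of u and v *)
have weighted_cs u v (s t : R) :
    (ip u v * s * t) ^+ 2 <= ip u u * s ^+ 2 * (ip v v * t ^+ 2).
  have -> : (ip u v * s * t) ^+ 2 = ip u v ^+ 2 * (s ^+ 2 * t ^+ 2) by ring.
  rewrite [leRHS]mulrACA ler_wpM2r ?ip_cauchy_schwarz //.
  by rewrite mulr_ge0 ?sqr_ge0.
apply: ge3_of_pairwise_mul_ge_sqr.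
- by rewrite !addr_ge0 // mulr_ge0 ?ip_ge0 ?sqr_ge0.
- by rewrite mulrAC weighted_cs.
- by rewrite (mulrC (ip x y)) mulrAC weighted_cs.
- have -> : ip x y * ip x z * ip y z = ip y z * ip x z * ip x y by ring.
  exact: weighted_cs.
Qed.

(** * Euclidean space *)

Section Euclidean.
Variables (R : realType) (n : nat).
Implicit Types u v : 'rV[R]_n.

Definition euclid_ip u v : R := \sum_i u 0 i * v 0 i.

Lemma euclid_ipC u v : euclid_ip u v = euclid_ip v u.
Proof. by apply: eq_bigr => i _; rewrite mulrC. Qed.

Lemma euclid_ip_linearr u : linear_for *%R (euclid_ip u).
Proof.
move=> a v w; rewrite /euclid_ip mulr_sumr -big_split /=.
by apply: eq_bigr => i _; rewrite !mxE; ring.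
Qed.

Lemma euclid_ip_bilinear :
  bilinear_for (GRing.Scale.Law.clone _ _ *%R _)
    (GRing.Scale.Law.clone _ _ (@idfun R \; *%R) _) euclid_ip.
Proof.
split=> [v|u] a w w' /=; last exact: euclid_ip_linearr.
by rewrite !(euclid_ipC _ v) euclid_ip_linearr.
Qed.

HB.instance Definition _ :=
  bilinear_isBilinear.Build R _ _ R _ _ euclid_ip euclid_ip_bilinear.

Lemma euclid_ip_hermitian u v :
  euclid_ip u v = (-1) ^+ false * @idfun R (euclid_ip v u).
Proof. by rewrite expr0 mul1r euclid_ipC. Qed.

HB.instance Definition _ :=
  isHermitianSesquilinear.Build R _ false (@idfun R) euclid_ip
    euclid_ip_hermitian.

Lemma euclid_ip_gt0 u : u != 0 -> 0 < euclid_ip u u.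
Proof.
move=> /rV0Pn[i ui_neq0]; rewrite /euclid_ip (bigD1 i) //=.
rewrite ltr_wpDr ?sumr_ge0 // => [j _|]; first by rewrite -expr2 sqr_ge0.
by rewrite -expr2 exprn_even_gt0.
Qed.

HB.instance Definition _ := isDotProduct.Build R _ euclid_ip euclid_ip_gt0.

End Euclidean.

Theorem corollary3p2 (R : realType) :
  (forall (H : lmodType R) (ip : {dot H for @idfun R}) (x y z : H),
     (0 < ip x y * ip x z * ip y z ->
        3 * (ip x y * ip x z * ip y z)
        <= ipnorm ip x ^+ 2 * ip y z ^+ 2 + ipnorm ip y ^+ 2 * ip x z ^+ 2
           + ipnorm ip z ^+ 2 * ip x y ^+ 2)
     /\
     (ip x y * ip x z * ip y z < 0 ->
        - 6 * (ip x y * ip x z * ip y z)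
        <= ipnorm ip x ^+ 2 * ip y z ^+ 2 + ipnorm ip y ^+ 2 * ip x z ^+ 2
           + ipnorm ip z ^+ 2 * ip x y ^+ 2))
  /\
  (exists (H : lmodType R) (ip : {dot H for @idfun R}) (x y z : H),
     0 < ip x y * ip x z * ip y z /\
     ipnorm ip x ^+ 2 * ip y z ^+ 2 + ipnorm ip y ^+ 2 * ip x z ^+ 2
       + ipnorm ip z ^+ 2 * ip x y ^+ 2
     = 3 * (ip x y * ip x z * ip y z))
  /\
  (exists (H : lmodType R) (ip : {dot H for @idfun R}) (x y z : H),
     ip x y * ip x z * ip y z < 0 /\
     ipnorm ip x ^+ 2 * ip y z ^+ 2 + ipnorm ip y ^+ 2 * ip x z ^+ 2
       + ipnorm ip z ^+ 2 * ip x y ^+ 2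
     = - 6 * (ip x y * ip x z * ip y z)).
Proof.
split=> [H ip x y z|]; first split=> _.
- by rewrite !ipnorm_sqr; exact: weighted_norms_ge3.
- by rewrite !ipnorm_sqr; exact: weighted_norms_ge_opp6.
pose rvec (s : seq R) : 'rV[R]_3 := \row_i s`_i.
split.
  exists 'rV[R]_1, (@euclid_ip R 1), (const_mx 1), (const_mx 1), (const_mx 1).
  rewrite !ipnorm_sqr /= /euclid_ip !big_ord1 !mxE.
  by split; [rewrite !mulr1 ltr01 | ring].
(* the differences of consecutive basis vectors of R^3: squared length 2 and
   pairwise inner products -1 *)
exists 'rV[R]_3, (@euclid_ip R 3),
  (rvec [:: 1; -1; 0]), (rvec [:: 0; 1; -1]), (rvec [:: -1; 0; 1]).
rewrite !ipnorm_sqr /= /euclid_ip !big_ord_recl !big_ord0 !mxE /=.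
by split; [lra | ring].
Qed.
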